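(* Let $M$ be a metric space and let $f:M\to M$ be a continuous map satisfying the gluing orbit property. Assume that the roof function $\rho:M\to\mathbb{R}_0^+$ is bounded from above and bounded away from zero, is uniformly continuous, and that the constants $$C_\xi:=\sup_{n\ge1}\ \sup_{x\in M}\ \sup_{y\in B(x,n,\xi)}|S_n\rho(x)-S_n\rho(y)|<\infty\quad\text{satisfy}\quad\lim_{\xi\to0}C_\xi=0,$$ where $S_n\rho=\sum_{j=0}^{n-1}\rho\circ f^j$. Then the suspension semiflow $(X_t)_t$ over $f$ with roof function $\rho$ has the gluing orbit property.
   Context: Bowen ball for $f$: $B(x,n,\xi)=\{y\in M:d(f^j(x),f^j(y))<\xi,\ j=0,\dots,n-1\}$. Gluing orbit property for maps: a continuous $f:M\to M$ on a metric space satisfies it if for any $\varepsilon>0$ there is an integer $N(\varepsilon)\ge1$ such that for any $k\ge1$, points $x_1,\dots,x_k\in M$ and positive integers $n_1,\dots,n_k$ there are integers $0\le p_1,\dots,p_k\le N(\varepsilon)$ and $x\in M$ with $d(f^j(x),f^j(x_1))\le\varepsilon$ for $0\le j\le n_1$ and $d(f^{j+n_1+p_1+\dots+n_{i-1}+p_{i-1}}(x),f^j(x_i))\le\varepsilon$ for every $2\le i\le k$ and $0\le j\le n_i$. Gluing orbit property for semiflows: a semiflow $(X_t)_{t\ge 0}$ on a metric space $(N,d)$ has it if for any $\varepsilon>0$ there is $T(\varepsilon)>0$ such that for any $k\ge 1$, points $x_1,\dots,x_k\in N$ and times $t_1,\dots,t_k\ge 0$ there are $0\le p_1,\dots,p_k\le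 T(\varepsilon)$ and $y\in N$ such that $d(X_t(y),X_t(x_1))<\varepsilon$ for all $t\in[0,t_1]$ and, for every $2\le i\le k$, writing $\underline{x}_i = X_{\sum_{j=1}^{i-1}(p_j+t_j)}(y)$, one has $d(X_t(\underline{x}_i),X_t(x_i))<\varepsilon$ for all $t\in[0,t_i]$. Suspension: $M_\rho=\{(x,t)\in M\times\mathbb{R}_0^+:0\le t\le\rho(x)\}/\sim$ with $(x,\rho(x))\sim(f(x),0)$, and $X_t(x,s)=(x,s+t)$ in the quotient, i.e. $X_t(x,s)=(f^n(x),s+t-S_n\rho(x))$ with $S_n\rho(x)\le s+t<S_{n+1}\rho(x)$. $M_\rho$ carries the Bowen-Walters distance $d_\rho$: when $\rho\equiv1$, set $d_h((x,t),(y,t))=(1-t)d(x,y)+t\,d(f(x),f(y))$ for points at the same height, and $d_v((x,t),(y,s))=\inf\{|r|:X_r(x,t)=(y,s)\}$ for points on the same orbit (either one being the earlier point); $d_1$ is the infimum of the lengths of paths (finite concatenations of horizontal and vertical segments) joining two points. In general $d_\rho((x,t),(y,s))=d_1((x,t/\rho(x)),(y,s/\rho(y)))$. *)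

(* Defs.v *)
From HB Require Import structures.
From Stdlib Require Import Relation_Operators.
From mathcomp Require Export all_boot all_order all_algebra.
From mathcomp Require Export generic_quotient.
From mathcomp Require Export all_classical all_reals all_analysis.
Export Order.TTheory GRing.Theory Num.Theory.
Export numFieldNormedType.Exports.

#[export] Set Implicit Arguments.
#[export] Unset Strict Implicit.
#[export] Unset Printing Implicit Defensive.

Open Scope classical_set_scope.
Open Scope ring_scope.

(* Orbit pieces are indexed from 0, so the sum runs over [l < i]; it is empty
   for [i = 0], which gives the unshifted condition on the first piece. *)
Definition map_gluing_orbit (R : realType) (M : metricType R) (f : M -> M) :=
  forall eps : R, 0 < eps ->
  exists N : nat, (1 <= N)%N /\
  forall (k : nat) (x : 'I_k -> M) (n : 'I_k -> nat),
  (1 <= k)%N -> (forall i, (0 < n i)%N) ->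
  exists (p : 'I_k -> nat) (z : M),
    (forall i, (p i <= N)%N) /\
    (forall (i : 'I_k) (j : nat), (j <= n i)%N ->
       mdist (iter (j + \sum_(l < k | (l < i)%N) (n l + p l)) f z)
             (iter j f (x i)) <= eps).

Definition flow_gluing_orbit (R : realType) (N : Type) (d : N -> N -> R)
    (X : R -> N -> N) :=
  forall eps : R, 0 < eps ->
  exists T : R, 0 < T /\
  forall (k : nat) (x : 'I_k -> N) (t : 'I_k -> R),
  (1 <= k)%N -> (forall i, 0 <= t i) ->
  exists (p : 'I_k -> R) (y : N),
    (forall i, 0 <= p i <= T) /\
    (forall (i : 'I_k) (s : R),
       0 <= s <= t i ->
       d (X s (if i == 0%N :> nat then y
               else X (\sum_(l < k | (l < i)%N) (p l + t l)) y))
         (X s (x i)) < eps).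

Section BirkhoffSums.
Context {R : realType} {M : metricType R} (f : M -> M) (rho : M -> R).

Definition birkhoff (n : nat) (x : M) : R := \sum_(j < n) rho (iter j f x).

Definition bowen_ball (x : M) (n : nat) (xi : R) : set M :=
  [set y | forall j, (j < n)%N -> mdist (iter j f x) (iter j f y) < xi].

(* C_xi; its finiteness is part of what has to be assumed, hence [\bar R]. *)
Definition bowen_variation (xi : R) : \bar R :=
  ereal_sup [set ereal_sup [set ereal_sup
    [set `|birkhoff n x - birkhoff n y|%:E | y in bowen_ball x n xi]
    | x in [set: M]] | n in [set n | (1 <= n)%N]].

End BirkhoffSums.

Section Suspension.
Context {R : realType} {M : metricType R} (f : M -> M) (rho : M -> R).

Definition in_cyl (p : M * R) : bool := 0 <= p.2 <= rho p.1.

Definition cyl := {p : M * R | in_cyl p}.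

(* The generating identifications (x, rho x) ~ (f x, 0). *)
Definition roof_glue (p q : cyl) : Prop :=
  (val p).2 = rho (val p).1 /\ val q = (f (val p).1, 0).

Definition cyl_rel (p q : cyl) : bool :=
  `[< clos_refl_sym_trans cyl roof_glue p q >].

Lemma cyl_rel_refl : reflexive cyl_rel.
Proof. by move=> p; apply/asboolP; exact: rst_refl. Qed.

Lemma cyl_rel_sym : symmetric cyl_rel.
Proof.
by move=> p q; apply/idP/idP => /asboolP h; apply/asboolP; exact: rst_sym.
Qed.

Lemma cyl_rel_trans : transitive cyl_rel.
Proof.
by move=> q p r /asboolP pq /asboolP qr; apply/asboolP; exact: rst_trans qr.
Qed.

Definition cyl_equiv := EquivRel cyl_rel cyl_rel_refl cyl_rel_sym cyl_rel_trans.

Definition susp := {eq_quot cyl_equiv}%qT.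

Definition to_susp (p : cyl) : susp := (\pi_susp p)%qT.

Definition floor_index (x : M) (u : R) : nat :=
  xget 0%N [set n | birkhoff f rho n x <= u < birkhoff f rho n.+1 x].

(* [insubd] only supplies the membership proof: its default value is not
   reached when [rho] is bounded away from zero and [0 <= t], see
   [susp_flowE]. *)
Definition cyl_flow (t : R) (p : cyl) : cyl :=
  let: (x, s) := val p in
  let n := floor_index x (s + t) in
  insubd p (iter n f x, s + t - birkhoff f rho n x).

Definition susp_flow (t : R) (a : susp) : susp := to_susp (cyl_flow t (repr a)).

Lemma cyl_rescale_subproof (p : cyl) :
  0 <= (val p).2 / rho (val p).1 <= 1.
Proof.
case: p => -[x s] /= /andP[s0 sr].
have r0 : 0 <= rho x by exact: le_trans sr.
rewrite divr_ge0//=; have [->|rn0] := eqVneq (rho x) 0.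
  by rewrite invr0 mulr0.
by rewrite ler_pdivrMr ?mul1r// lt_def rn0.
Qed.

End Suspension.

Arguments to_susp {R M} f rho p.

Section BowenWalters.
Context {R : realType} {M : metricType R} (f : M -> M).

Local Notation roof1 := (fun _ : M => 1 : R).
Local Notation susp1 := (susp f roof1).

Definition horizontal_segment (a b : susp1) (l : R) : Prop :=
  exists p q : cyl roof1,
    [/\ (val p).2 = (val q).2, a = to_susp f roof1 p, b = to_susp f roof1 q &
        l = (1 - (val p).2) * mdist (val p).1 (val q).1
            + (val p).2 * mdist (f (val p).1) (f (val q).1)].

(* [|r|] for those real [r] with X_r a = b, where a negative [r] means that
   [b] is the earlier of the two points. *)
Definition connecting_times (a b : susp1) : set R :=
  [set r | 0 <= r /\ (susp_flow r a = b \/ susp_flow r b = a)].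

Definition vertical_segment (a b : susp1) (l : R) : Prop :=
  connecting_times a b !=set0 /\ l = inf (connecting_times a b).

(* [bw_path a b l]: some path of length [l] joins [a] to [b]. *)
Inductive bw_path : susp1 -> susp1 -> R -> Prop :=
| bw_path_nil a : bw_path a a 0
| bw_path_cons a b c l l' :
    horizontal_segment a b l \/ vertical_segment a b l ->
    bw_path b c l' -> bw_path a c (l + l').

(* The set of lengths is nonempty (go down to height 0, across, and up again)
   and bounded below by 0, so [inf] is a genuine infimum. *)
Definition bw_dist1 (a b : susp1) : R := inf [set l | bw_path a b l].

Context (rho : M -> R).

Definition cyl_rescale (p : cyl rho) : cyl roof1 :=
  Sub ((val p).1, (val p).2 / rho (val p).1) (cyl_rescale_subproof p).

Definition susp_rescale (a : susp f rho) : susp1 :=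
  to_susp f roof1 (cyl_rescale (repr a)).

Definition bw_dist (a b : susp f rho) : R :=
  bw_dist1 (susp_rescale a) (susp_rescale b).

End BowenWalters.

(* [susp_flow] and [susp_rescale] do not depend on the representative picked
   by [repr]. *)
Section WellDefined.
Context {R : realType} {M : metricType R} (f : M -> M) (rho : M -> R).
Context (c : R) (c0 : 0 < c) (rhoc : forall x, c <= rho x).

Let rho0 x : 0 < rho x. Proof. exact: lt_le_trans (rhoc x). Qed.

Lemma birkhoffS n x :
  birkhoff f rho n.+1 x = rho x + birkhoff f rho n (f x).
Proof.
rewrite /birkhoff big_ord_recl; congr (_ + _); apply: eq_bigr => i _.
by rewrite [lift _ _]/= /bump /= -iterS iterSr.
Qed.

Lemma birkhoff_mono x :
  {homo (birkhoff f rho)^~ x : m n / (m <= n)%N >-> m <= n}.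
Proof.
move=> m n mn; rewrite -(subnKC mn); elim: (n - m)%N => [|k ih].
  by rewrite addn0.
by rewrite addnS /birkhoff big_ord_recr/=; apply: ler_wpDr => //; exact: ltW.
Qed.

Lemma floor_indexP x u n :
  birkhoff f rho n x <= u < birkhoff f rho n.+1 x -> floor_index f rho x u = n.
Proof.
move=> nP; apply: xget_unique => // m /andP[mu um].
case/andP: nP => nu un; apply/eqP; rewrite eqn_leq; apply/andP; split.
  rewrite leqNgt; apply/negP => nm.
  by have := lt_le_trans un (birkhoff_mono x nm); rewrite ltNge mu.
rewrite leqNgt; apply/negP => mn.
by have := lt_le_trans um (birkhoff_mono x mn); rewrite ltNge nu.
Qed.

Lemma floor_index_ex x u : 0 <= u ->
  exists n, birkhoff f rho n x <= u < birkhoff f rho n.+1 x.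
Proof.
move=> u0.
have Bge n : n%:R * c <= birkhoff f rho n x.
  elim: n => [|n ih]; first by rewrite mul0r /birkhoff big_ord0.
  rewrite /birkhoff big_ord_recr/= -addn1 natrD mulrDl mul1r.
  by apply: lerD.
have ex : exists n, u < birkhoff f rho n x.
  exists (Num.truncn (u / c)).+1; apply: lt_le_trans (Bge _).
  by rewrite -ltr_pdivrMr// truncnS_gt.
case: (ex_minnP ex) => -[|n] un nmin.
  by move: un; rewrite /birkhoff big_ord0 ltNge u0.
exists n; rewrite un andbT leNgt; apply/negP => /nmin.
by rewrite ltnn.
Qed.

Lemma cyl_flowE t (p : cyl rho) n
    (h : birkhoff f rho n (val p).1 <= (val p).2 + t
         < birkhoff f rho n.+1 (val p).1) :
  val (cyl_flow f t p)
  = (iter n f (val p).1, (val p).2 + t - birkhoff f rho n (val p).1).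
Proof.
rewrite /cyl_flow; case: p h => -[x s] sP /= h.
rewrite (floor_indexP h) val_insubd ifT// /in_cyl/=.
case/andP: h => h1 h2; rewrite subr_ge0 h1/= lerBlDl.
by rewrite (le_trans (ltW h2))// /birkhoff big_ord_recr.
Qed.

Lemma roof_glue_flow t (p q : cyl rho) : 0 <= t -> roof_glue f p q ->
  cyl_flow f t p = cyl_flow f t q.
Proof.
move=> t0 [pr qE]; apply: val_inj.
have [n nP] := floor_index_ex (f (val p).1) t0.
have nP' : birkhoff f rho n (val q).1 <= (val q).2 + t
           < birkhoff f rho n.+1 (val q).1 by rewrite qE/= add0r.
rewrite (cyl_flowE nP') (@cyl_flowE _ _ n.+1); last first.
  by rewrite !(birkhoffS _ (val p).1) pr lerD2l ltrD2l.
rewrite qE [(_, 0).1]/= [(_, 0).2]/= pr birkhoffS iterSr add0r.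
by rewrite opprD addrACA subrr add0r.
Qed.

Lemma roof_glue_rescale (p q : cyl rho) : roof_glue f p q ->
  roof_glue f (cyl_rescale p) (cyl_rescale q).
Proof.
by move=> [pr qE]; split => /=; rewrite ?qE/= ?mul0r// pr divff// gt_eqF.
Qed.

Lemma to_susp_eqP (r : M -> R) (p q : cyl r) :
  to_susp f r p = to_susp f r q <->
  clos_refl_sym_trans (cyl r) (@roof_glue _ _ f r) p q.
Proof.
split=> [/(eqquotP (susp f r))/asboolP//|h].
by apply/(eqquotP (susp f r))/asboolP.
Qed.

Lemma susp_flow_pi t (p : cyl rho) : 0 <= t ->
  susp_flow t (to_susp f rho p) = to_susp f rho (cyl_flow f t p).
Proof.
move=> t0; rewrite /susp_flow; congr (to_susp _ _ _).
have : to_susp f rho (repr (to_susp f rho p)) = to_susp f rho p by exact: reprK.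
move/to_susp_eqP; move: (repr _) => q.
by elim=> // [a b ab|a b d _ -> _ ->//]; exact: roof_glue_flow.
Qed.

Lemma susp_flowE t (p q : cyl rho) n : 0 <= t ->
  birkhoff f rho n (val p).1 <= (val p).2 + t
    < birkhoff f rho n.+1 (val p).1 ->
  val q = (iter n f (val p).1, (val p).2 + t - birkhoff f rho n (val p).1) ->
  susp_flow t (to_susp f rho p) = to_susp f rho q.
Proof.
move=> t0 h qE; rewrite susp_flow_pi//; congr (to_susp _ _ _).
by apply: val_inj; rewrite (cyl_flowE h).
Qed.

Lemma susp_rescaleE (p : cyl rho) :
  susp_rescale (to_susp f rho p) = to_susp f (fun=> 1) (cyl_rescale p).
Proof.
apply/to_susp_eqP.
have : to_susp f rho (repr (to_susp f rho p)) = to_susp f rho p by exact: reprK.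
move/to_susp_eqP; move: (repr _) => q; elim=> [a b ab|a|a b _|a b d _ ab _ bd].
- by apply: rst_step; exact: roof_glue_rescale.
- exact: rst_refl.
- exact: rst_sym.
- exact: rst_trans bd.
Qed.

End WellDefined.

(* Main.v *)
Require Import Defs.
From Stdlib Require Import Relation_Operators.
From mathcomp Require Import ring lra.

(* Every point of the suspension is [X_s (m, 0)] with [0 <= s <= rho m]. Given
   orbit pieces starting at [X_(s_i) (m_i, 0)] of duration [t_i], follow [m_i]
   under [f] for enough iterates to cover the time [s_i + t_i], and glue these
   pieces in [M] into the orbit of some [z], visiting [m_i] from [z_i] on. The
   orbit of [(z, 0)] is then at [X_(s_i) (z_i, 0)] at the right times, the gaps
   being bounded by Birkhoff sums with a bounded number of terms outside
   [s_i, s_i + t_i]. If the [f]-orbits of [x] and [y] stay close then their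
   Birkhoff sums differ by at most C_xi, so [X_u (x, 0)] and [X_u (y, 0)] are
   joined by one short horizontal segment and a vertical one of length at most
   C_xi / inf rho: the time at which [(x, 0)] reaches the relative height that
   [(y, 0)] has at time [u] differs from [u] by a convex combination of two
   differences of Birkhoff sums. *)

(** * Birkhoff sums and the time change to roof [1] *)

Section BirkhoffClock.
Context {R : realType} {M : metricType R} (f : M -> M) (rho : M -> R).
Context (c : R) (c0 : 0 < c) (rhoc : forall x, c <= rho x).

Local Notation B := (birkhoff f rho).

Let rho_gt0 x : 0 < rho x. Proof. exact: lt_le_trans (rhoc x). Qed.

Lemma birkhoff0 x : B 0 x = 0.
Proof. by rewrite /birkhoff big_ord0. Qed.

Lemma birkhoffSr n x : B n.+1 x = B n x + rho (iter n f x).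
Proof. by rewrite /birkhoff big_ord_recr. Qed.

Lemma birkhoffD m n x : B (m + n) x = B m x + B n (iter m f x).
Proof.
elim: n => [|n ih]; first by rewrite addn0 birkhoff0 addr0.
by rewrite addnS !birkhoffSr ih addrA -iterD addnC.
Qed.

Lemma birkhoff_ge n x : n%:R * c <= B n x.
Proof.
elim: n => [|n ih]; first by rewrite mul0r birkhoff0.
by rewrite birkhoffSr -natr1 mulrDl mul1r lerD.
Qed.

Lemma birkhoff_ge0 n x : 0 <= B n x.
Proof. by rewrite (le_trans _ (birkhoff_ge n x))// mulr_ge0// ltW. Qed.

Lemma birkhoff_le (K : R) n x : (forall y, rho y <= K) -> B n x <= n%:R * K.
Proof.
move=> rhoK; elim: n => [|n ih]; first by rewrite mul0r birkhoff0.
by rewrite birkhoffSr -natr1 mulrDl mul1r lerD.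
Qed.

Lemma floor_le x (u v : R) m n : u <= v ->
  B m x <= u -> v < B n.+1 x -> (m <= n)%N.
Proof.
move=> uv mu vn; rewrite leqNgt; apply/negP => nm.
have := birkhoff_mono f c0 rhoc x nm; rewrite leNgt => /negP; apply.
by rewrite (le_lt_trans mu)// (le_lt_trans uv).
Qed.

(* The time at which the orbit of [(x, 0)] under the flow with roof [1] reaches
   the rescaling of [X_u (x, 0)]. *)
Definition clock x u : R :=
  let n := floor_index f rho x u in n%:R + (u - B n x) / rho (iter n f x).

Lemma clockE x u n : B n x <= u < B n.+1 x ->
  clock x u = n%:R + (u - B n x) / rho (iter n f x).
Proof. by move=> h; rewrite /clock (floor_indexP c0 rhoc h). Qed.

Lemma clock_ge0 x (u : R) : 0 <= u -> 0 <= clock x u.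
Proof.
move=> /(floor_index_ex f c0 rhoc x)[n /[dup] h /andP[nu _]].
by rewrite (clockE h) addr_ge0// divr_ge0 ?subr_ge0// ltW.
Qed.

(** Over each [y] the clock advances at rate [1 / rho y], which lies between [0] and [1 / c]. *)
Lemma clock_le x (u v : R) : 0 <= u -> u <= v ->
  clock x u <= clock x v <= clock x u + (v - u) / c.
Proof.
move=> u0 uv; have v0 := le_trans u0 uv.
have [m /[dup] mP /andP[mu um]] := floor_index_ex f c0 rhoc x u0.
have [n /[dup] nP /andP[nv vn]] := floor_index_ex f c0 rhoc x v0.
rewrite (clockE mP) (clockE nP).
have divc (a : R) y : 0 <= a -> 0 <= a / rho y <= a / c.
  move=> a0; rewrite divr_ge0 ?(ltW (rho_gt0 _))//=.
  by rewrite ler_wpM2l// lef_pV2// posrE.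
move: (floor_le uv mu vn); rewrite leq_eqVlt => /predU1P[mn|mn].
  subst n.
  have := divc (v - u) (iter m f x); rewrite subr_ge0 => /(_ uv).
  rewrite !mulrBl => /andP[? ?]; apply/andP; split; lra.
(* Split the time between the two points at the first and last visits to the
   base. *)
pose k := (n - m.+1)%N.
have nE : n = (m.+1 + k)%N by rewrite subnKC.
have Bn : B m.+1 x + k%:R * c <= B n x.
  by rewrite nE birkhoffD lerD2l birkhoff_ge.
have nR : n%:R = m%:R + 1 + k%:R :> R by rewrite nE natrD -natr1.
have um0 : 0 <= B m.+1 x - u by rewrite subr_ge0 ltW.
have nv0 : 0 <= v - B n x by rewrite subr_ge0.
have /andP[a0 a1] := divc _ (iter n f x) nv0.
have /andP[b0 b1] := divc _ (iter m f x) um0.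
have bE : (B m.+1 x - u) / rho (iter m f x)
    = 1 - (u - B m x) / rho (iter m f x).
  by rewrite birkhoffSr; field; rewrite gt_eqF.
rewrite bE in b0 b1.
(* Each of the [k] complete fibres in between takes time at least [c]. *)
have k1 : k%:R <= (B n x - B m.+1 x) / c by rewrite ler_pdivlMr//; lra.
have sum_c : (v - B n x) / c + (B m.+1 x - u) / c + (B n x - B m.+1 x) / c
    = (v - u) / c by ring.
have k0 : 0 <= k%:R :> R by [].
rewrite nR; apply/andP; split; lra.
Qed.

Lemma clock_dist x (u v : R) : 0 <= u -> 0 <= v ->
  `|clock x u - clock x v| <= `|u - v| / c.
Proof.
move=> u0 v0; wlog uv : u v u0 v0 / u <= v => [hw|].
  have [uv|/ltW vu] := leP u v; first exact: hw.
  by rewrite distrC (distrC u) hw.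
have /andP[? ?] := clock_le x u0 uv.
by rewrite distrC (distrC u) !ger0_norm ?subr_ge0// lerBlDl.
Qed.

End BirkhoffClock.

(** * Orbits of base points under the suspension flow *)

Section Orbit.
Context {R : realType} {M : metricType R} (f : M -> M) (rho : M -> R).
Context (rho_ge0 : forall x, 0 <= rho x) (c : R) (c0 : 0 < c)
  (rhoc : forall x, c <= rho x).

Local Notation B := (birkhoff f rho).

Lemma base_subproof x : in_cyl rho (x, 0).
Proof. by rewrite /in_cyl lexx rho_ge0. Qed.

Definition base x : cyl rho := exist _ (x, 0) (base_subproof x).

Definition orbit_pt x u : susp f rho := susp_flow u (to_susp f rho (base x)).

(* Both endpoints are allowed, thanks to the gluing of the roof to the base. *)
Lemma orbit_ptE x (u : R) n (q : cyl rho) : B n x <= u <= B n.+1 x ->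
  val q = (iter n f x, u - B n x) -> orbit_pt x u = to_susp f rho q.
Proof.
move=> /andP[nu un] qE.
have u0 : 0 <= u by rewrite (le_trans _ nu)// (birkhoff_ge0 f c0 rhoc).
move: un; rewrite le_eqVlt => /predU1P[uE|un]; last first.
  by apply: (susp_flowE c0 rhoc (n := n)); rewrite //= add0r ?nu.
pose q' := base (iter n.+1 f x).
rewrite /orbit_pt (susp_flowE c0 rhoc (q := q') (n := n.+1))//=.
- apply/to_susp_eqP; apply: rst_sym; apply: rst_step.
  by split; rewrite qE//= uE birkhoffSr addrC addKr.
- by rewrite add0r uE lexx/= [ltRHS]birkhoffSr ltrDl (lt_le_trans c0).
- by rewrite add0r uE subrr.
Qed.

Lemma orbit_pt_onto (a : susp f rho) :
  exists x (s : R), [/\ 0 <= s <= rho x & a = orbit_pt x s].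
Proof.
rewrite -[a]reprK; case: (repr a) => -[x s] h.
exists x, s; split=> //; symmetry; apply: (orbit_ptE (n := 0)).
  by rewrite birkhoffSr !birkhoff0 add0r.
by rewrite birkhoff0 subr0.
Qed.

Lemma orbit_pt_cyl x (u : R) n : B n x <= u <= B n.+1 x ->
  exists2 q : cyl rho, val q = (iter n f x, u - B n x) &
  orbit_pt x u = to_susp f rho q.
Proof.
move=> h; have qP : in_cyl rho (iter n f x, u - B n x).
  by case/andP: (h) => ? ?; rewrite /in_cyl/= subr_ge0 lerBlDl -birkhoffSr h.
by exists (exist (in_cyl rho) _ qP) => //; exact: orbit_ptE h _.
Qed.

(** The semigroup law: by the cocycle identity [birkhoffD], the numbers of returns to the base add
    up. *)
Lemma susp_flow_orbit_pt x (u t : R) : 0 <= u -> 0 <= t ->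
  susp_flow t (orbit_pt x u) = orbit_pt x (u + t).
Proof.
move=> u0 t0.
have [n /andP[nu un]] := floor_index_ex f c0 rhoc x u0.
have [|q qE ->] := @orbit_pt_cyl x u n; first by rewrite nu ltW.
have v0 : 0 <= (val q).2 + t by rewrite qE/= addr_ge0// subr_ge0.
have [m /andP[]] := floor_index_ex f c0 rhoc (val q).1 v0.
rewrite qE/= => mv vm.
have [|q' q'E ->] := @orbit_pt_cyl x (u + t) (n + m).
  by rewrite -addnS !birkhoffD; apply/andP; split; lra.
apply: (susp_flowE c0 rhoc (n := m)); rewrite // qE/= ?mv//.
by rewrite q'E birkhoffD -iterD addnC; congr pair; ring.
Qed.

Lemma orbit_pt_shift x n (u : R) : 0 <= u ->
  orbit_pt x (B n x + u) = orbit_pt (iter n f x) u.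
Proof.
move=> u0; have [m /andP[mu um]] := floor_index_ex f c0 rhoc (iter n f x) u0.
have [|q qE ->] := @orbit_pt_cyl (iter n f x) u m; first by rewrite mu ltW.
apply: (orbit_ptE (n := n + m)).
  by rewrite -addnS !birkhoffD; apply/andP; split; lra.
by rewrite qE birkhoffD -iterD addnC; congr pair; ring.
Qed.

End Orbit.

Arguments orbit_pt {R M} f {rho} rho_ge0 x u.

(** * Vertical and horizontal segments over roof [1] *)

Section BowenWaltersPaths.
Context {R : realType} {M : metricType R} (f : M -> M).

Local Notation roof1 := (fun _ : M => 1 : R).
Local Notation orb1 := (orbit_pt f (fun _ : M => @ler01 R)).

Let le11 (x : M) : (1 : R) <= 1. Proof. exact: lexx. Qed.

Lemma birkhoff1 n (x : M) : birkhoff f roof1 n x = n%:R.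
Proof. by rewrite /birkhoff sumr_const card_ord. Qed.

Lemma horizontal_segment_ge0 (a b : susp f roof1) l :
  horizontal_segment a b l -> 0 <= l.
Proof.
move=> [[p /= pP] [q [_ _ _ ->]]]; move: pP => /andP[p0 p1].
by rewrite addr_ge0// mulr_ge0 ?subr_ge0 ?mdist_ge0.
Qed.

Lemma vertical_segment_ge0 (a b : susp f roof1) l :
  vertical_segment a b l -> 0 <= l.
Proof. by move=> [ab ->]; apply: lb_le_inf => // r []. Qed.

Lemma bw_path_ge0 (a b : susp f roof1) l : bw_path a b l -> 0 <= l.
Proof.
elim=> // {a b l} a b d l l' [/horizontal_segment_ge0|/vertical_segment_ge0];
  by move=> l0 _; exact: addr_ge0.
Qed.

Lemma bw_dist1_le (a b : susp f roof1) l : bw_path a b l -> bw_dist1 a b <= l.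
Proof. by move=> h; apply: ge_inf => //; exists 0 => ? /bw_path_ge0. Qed.

(** [|u - v|] is one connecting time; on a periodic orbit there may be shorter ones, hence only an
    inequality. *)
Lemma vertical_orbit_pt x (u v : R) : 0 <= u -> 0 <= v ->
  exists2 l, l <= `|u - v| & vertical_segment (orb1 x u) (orb1 x v) l.
Proof.
move=> u0 v0.
have ct : connecting_times (orb1 x u) (orb1 x v) `|u - v|.
  split=> //; have [uv|/ltW vu] := leP u v; [left|right].
    rewrite distrC ger0_norm ?subr_ge0//.
    by rewrite (susp_flow_orbit_pt f _ ltr01 le11) ?subr_ge0// subrKC.
  rewrite ger0_norm ?subr_ge0//.
  by rewrite (susp_flow_orbit_pt f _ ltr01 le11) ?subr_ge0// subrKC.
exists (inf (connecting_times (orb1 x u) (orb1 x v))).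
  by apply: ge_inf => //; exists 0 => r [].
by split => //; exists `|u - v|.
Qed.

(** The length at height [h] is a convex combination of the distances at iterates [n] and [n.+1]. *)
Lemma horizontal_orbit_pt x y n (h eta : R) : 0 <= h <= 1 ->
  mdist (iter n f x) (iter n f y) <= eta ->
  mdist (iter n.+1 f x) (iter n.+1 f y) <= eta ->
  exists2 l, l <= eta &
    horizontal_segment (orb1 x (n%:R + h)) (orb1 y (n%:R + h)) l.
Proof.
move=> /andP[h0 h1] d0 d1.
have B1 z : birkhoff f roof1 n z <= n%:R + h <= birkhoff f roof1 n.+1 z.
  by rewrite !birkhoff1 -natr1 lerDl h0 lerD2l.
have [p pE ->] := orbit_pt_cyl (fun=> ler01) ltr01 le11 (B1 x).
have [q qE ->] := orbit_pt_cyl (fun=> ler01) ltr01 le11 (B1 y).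
rewrite birkhoff1 addrC addKr in pE; rewrite birkhoff1 addrC addKr in qE.
exists ((1 - h) * mdist (iter n f x) (iter n f y)
  + h * mdist (iter n.+1 f x) (iter n.+1 f y)); last first.
  by exists p, q; split; rewrite // pE qE.
have := ler_wpM2l h0 d1.
have := ler_wpM2l (_ : 0 <= 1 - h) d0; rewrite subr_ge0 => /(_ h1).
lra.
Qed.

End BowenWaltersPaths.

(** * From close base orbits to close suspension orbits *)

Section Closeness.
Context {R : realType} {M : metricType R} (f : M -> M) (rho : M -> R).
Context (rho_ge0 : forall x, 0 <= rho x) (c : R) (c0 : 0 < c)
  (rhoc : forall x, c <= rho x).

Local Notation B := (birkhoff f rho).

Lemma susp_rescale_orbit_pt x (u : R) : 0 <= u ->
  susp_rescale (orbit_pt f rho_ge0 x u)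
  = orbit_pt f (fun=> ler01) x (clock f rho x u).
Proof.
move=> u0; have [n /[dup] nP /andP[nu un]] := floor_index_ex f c0 rhoc x u0.
rewrite (clockE c0 rhoc nP).
have [|q qE ->] := @orbit_pt_cyl _ _ f rho rho_ge0 _ c0 rhoc x u n.
  by rewrite nu ltW.
rewrite (susp_rescaleE f c0 rhoc); symmetry.
have rho0 y : 0 < rho y by exact: lt_le_trans (rhoc y).
apply: (orbit_ptE _ ltr01 (fun=> lexx _) (n := n)).
  rewrite !birkhoff1 -natr1 lerDl lerD2l divr_ge0 ?subr_ge0//=.
  by rewrite ler_pdivrMr// mul1r lerBlDl -birkhoffSr ltW.
by rewrite /= qE/= birkhoff1 [_%:R + _]addrC addrK.
Qed.

Lemma birkhoff_bowen_ball_le (x y : M) n (xi eta : R) : 0 <= eta ->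
  (bowen_variation f rho xi < eta%:E)%E ->
  bowen_ball f x n xi y -> `|B n x - B n y| <= eta.
Proof.
(* The supremum only ranges over positive lengths; for length [0] both sums vanish. *)
case: n => [|n] eta0 Ceta xy; first by rewrite !birkhoff0 subrr normr0.
rewrite -lee_fin; apply: ltW; apply: le_lt_trans Ceta.
apply: le_trans (ereal_sup_ubound _); last by exists n.+1.
apply: le_trans (ereal_sup_ubound _); last by exists x.
by apply: ereal_sup_ubound; exists y.
Qed.

Lemma bw_dist_orbit_pt_le (x y : M) n (u delta eta : R) :
  0 <= u -> u < B n y ->
  (forall j, (j <= n)%N -> mdist (iter j f x) (iter j f y) <= delta) ->
  (forall j, (j <= n)%N -> `|B j y - B j x| <= eta) ->
  bw_dist (orbit_pt f rho_ge0 x u) (orbit_pt f rho_ge0 y u) <= delta + eta / c.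
Proof.
move=> u0 un dxy Bxy.
have rho0 z : 0 < rho z by exact: lt_le_trans (rhoc z).
have [j /[dup] jP /andP[ju uj]] := floor_index_ex f c0 rhoc y u0.
(* The horizontal segment over iterate [j] also needs closeness at [j.+1], so [j] must stay strictly
   below [n]. *)
have jn : (j < n)%N.
  case: n un {dxy Bxy} => [|n] un.
    by move: un; rewrite birkhoff0 ltNge u0.
  by rewrite ltnS (floor_le c0 rhoc (lexx u) ju un).
pose h := (u - B j y) / rho (iter j f y).
have h0 : 0 <= h by rewrite divr_ge0 ?subr_ge0.
have h1 : h < 1 by rewrite ltr_pdivrMr// mul1r ltrBlDl -birkhoffSr.
(* At time [v] the orbit of [x] has the relative height that the orbit of [y]
   has at time [u]. *)
pose v := B j x + h * rho (iter j f x).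
have v0 : 0 <= v by rewrite addr_ge0 ?(birkhoff_ge0 f c0 rhoc)// mulr_ge0.
have clock_v : clock f rho x v = j%:R + h.
  rewrite (clockE c0 rhoc (n := j)).
    by rewrite /v [B j x + _]addrC addrK mulfK// gt_eqF.
  by rewrite birkhoffSr lerDl mulr_ge0//= ltrD2l gtr_pMl.
have uv : `|u - v| <= eta.
  have -> : u - v = (1 - h) * (B j y - B j x) + h * (B j.+1 y - B j.+1 x).
    have uE : u = B j y + h * rho (iter j f y).
      by rewrite mulrVK ?unitfE ?gt_eqF// subrKC.
    by rewrite {1}uE /v !birkhoffSr; ring.
  have h1' : 0 <= 1 - h by rewrite subr_ge0 ltW.
  rewrite (le_trans (ler_normD _ _))// (normrM h) (normrM (1 - h)).
  rewrite (ger0_norm h0) (ger0_norm h1').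
  have := ler_wpM2l h0 (Bxy _ jn); have := ler_wpM2l h1' (Bxy _ (ltnW jn)).
  lra.
rewrite /bw_dist !susp_rescale_orbit_pt// (clockE c0 rhoc jP) -/h.
have [||l l_le vert] := @vertical_orbit_pt _ _ f x (clock f rho x u) (j%:R + h).
- exact: clock_ge0 c0 rhoc _ _ u0.
- by rewrite addr_ge0.
have h01 : 0 <= h <= 1 by rewrite h0 ltW.
have [l' l'_le hor] := horizontal_orbit_pt h01 (dxy _ (ltnW jn)) (dxy _ jn).
have pth := bw_path_cons (or_intror vert)
  (bw_path_cons (or_introl hor) (bw_path_nil _)).
rewrite (le_trans (bw_dist1_le pth))// addr0 addrC lerD//.
rewrite (le_trans l_le)// -clock_v (le_trans (clock_dist f c0 rhoc x u0 v0))//.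
by rewrite ler_wpM2r// invr_ge0 ltW.
Qed.

End Closeness.

(** * Partial sums, and the gluing of orbit pieces *)

Lemma sum_ord_ltS (V : nmodType) k (F : 'I_k -> V) (i : 'I_k) :
  \sum_(l < k | (l < i.+1)%N) F l = F i + \sum_(l < k | (l < i)%N) F l.
Proof.
rewrite (bigD1 i)//=; congr (_ + _); apply: eq_bigl => l.
by rewrite ltnS ltn_neqAle andbC -val_eqE.
Qed.

Lemma sum_ord_telescope (V : zmodType) k (g : nat -> V) i : (i <= k)%N ->
  \sum_(l < k | (l < i)%N) (g l.+1 - g l) = g i - g 0%N.
Proof.
elim: i => [|i ih] ik; first by rewrite big_pred0 ?subrr.
rewrite (sum_ord_ltS _ (Ordinal ik)) ih ?(ltnW ik)//=.
by rewrite addrA subrK.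
Qed.

Theorem theorem6 (R : realType) (M : metricType R) (f : M -> M) (rho : M -> R)
  (f_cont : continuous f)
  (f_glue : map_gluing_orbit f)
  (rho_ge0 : forall x, 0 <= rho x)
  (rho_bdd_above : exists K : R, forall x, rho x <= K)
  (rho_away_from_0 : exists2 c : R, 0 < c & forall x, c <= rho x)
  (rho_ucont : unif_continuous rho)
  (C_fin : \forall xi \near 0^'+, (bowen_variation f rho xi < +oo)%E)
  (C_lim : bowen_variation f rho xi @[xi --> 0^'+] --> 0%E) :
  flow_gluing_orbit (@bw_dist R M f rho) (@susp_flow R M f rho).
Proof.
move=> eps eps0.
have [K0 rhoK0] := rho_bdd_above; have [c c0 rhoc] := rho_away_from_0.
(* The maximum keeps [K] positive even if [M] is empty. *)
pose K := Num.max K0 c.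
have cK : c <= K by rewrite le_max lexx orbT.
have rhoK x : rho x <= K by rewrite le_max rhoK0.
(* The bound [c] keeps the gaps nonnegative; the other one limits the vertical segment to
   [eps / 4]. *)
pose eta := Num.min c (eps * c / 4).
have eta0 : 0 < eta by rewrite lt_min c0 divr_gt0// mulr_gt0.
have eta_c : eta <= c by rewrite ge_min lexx.
have eta_eps : eta / c <= eps / 4.
  by rewrite ler_pdivrMr// mulrAC ge_min lexx orbT.
have [xi [xi0 xi_eps Cxi]] : exists xi : R,
    [/\ 0 < xi, xi < eps & (bowen_variation f rho xi < eta%:E)%E].
  have Cnear : \forall xi \near 0^'+, (bowen_variation f rho xi < eta%:E)%E.
    exact: (C_lim _ (nbhs_open_ereal_lt (f := fun=> eta) eta0)).
  near (0 : R)^'+ => xi; exists xi; split; near: xi => //.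
    exact: nbhs_right_gt.
  exact: nbhs_right_lt.
(* Gluing gives a weak inequality and Bowen balls need a strict one, hence half of [xi]. *)
have [N [_ glueN]] := f_glue _ (divr_gt0 xi0 (ltr0Sn R 1)).
(* A gap costs at most [N * K] for the gluing, [2 * K] for the iterates from [j i] to [(j i).+2],
   [K] for [eta], and [K] for the starting height of the next piece. *)
exists ((N + 4)%:R * K); split.
  by rewrite mulr_gt0// ?ltr0n ?addn4// (lt_le_trans c0).
move=> k a t k0 t0.
have [m /choice[s ams]] :=
  choice (fun i => orbit_pt_onto rho_ge0 c0 rhoc (a i)).
have st0 i : 0 <= s i + t i by rewrite addr_ge0//; case: (ams i) => /andP[].
have [j jP] := choice (fun i => floor_index_ex f c0 rhoc (m i) (st0 i)).
(* One iterate more than needed to cover [s i + t i] absorbs the variation of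
   the Birkhoff sums, so that the gaps are nonnegative. *)
have [p [z [pN zP]]] := glueN k m (fun i => (j i).+2) k0 (fun=> isT).
pose L i := (\sum_(l < k | (l < i)%N) ((j l).+2 + p l))%N.
pose zz i := iter (L i) f z.
have zzP (i : 'I_k) q : (q <= (j i).+2)%N ->
    mdist (iter q f (zz i)) (iter q f (m i)) <= xi / 2.
  by move=> qj; rewrite -iterD; exact: zP.
have Bzz (i : 'I_k) q : (q <= (j i).+2)%N ->
    `|birkhoff f rho q (m i) - birkhoff f rho q (zz i)| <= eta.
  move=> qj; apply: birkhoff_bowen_ball_le Cxi _; first exact: ltW.
  move=> r rq; rewrite metric_sym (le_lt_trans (zzP _ _ _))//.
    exact: leq_trans (ltnW rq) qj.
  lra.
(* [sz] extends [s] by [0], so that the last gap need not be treated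
   separately. *)
pose sz i := if insub i is Some i' then s i' else 0.
have szE (i : 'I_k) : sz i = s i by rewrite /sz valK.
have sz_bd i : 0 <= sz i <= K.
  rewrite /sz; case: insub => [i'|]; last by rewrite lexx (le_trans _ cK)// ltW.
  by case: (ams i') => /andP[-> h] _; exact: le_trans h _.
(* The gap lasts from the end of piece [i] until the orbit reaches the base at [zz i.+1], and then
   for a further time [sz i.+1]. *)
pose P (i : 'I_k) :=
  birkhoff f rho ((j i).+2 + p i)%N (zz i) - (s i + t i) + sz i.+1.
have P_bd i : 0 <= P i <= (N + 4)%:R * K.
  have /andP[jst stj] := jP i.
  have B2 := birkhoffSr f rho (j i).+1 (m i).
  have B1 := birkhoffSr f rho (j i) (m i).
  have := Bzz i _ (leqnn _); rewrite ler_norml => /andP[Bz1 Bz2].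
  have Bp1 := birkhoff_ge0 f c0 rhoc (p i) (iter (j i).+2 f (zz i)).
  have Bp2 : birkhoff f rho (p i) (iter (j i).+2 f (zz i)) <= N%:R * K.
    rewrite (le_trans (birkhoff_le _ _ _ rhoK))// ler_wpM2r ?ler_nat//.
    by rewrite (le_trans _ cK)// ltW.
  have /andP[sz0 szK] := sz_bd i.+1.
  have := rhoK (iter (j i) f (m i)); have := rhoK (iter (j i).+1 f (m i)).
  have := rhoc (iter (j i).+1 f (m i)).
  rewrite /P birkhoffD natrD mulrDl.
  by move=> *; apply/andP; split; lra.
exists P, (orbit_pt f rho_ge0 z (sz 0%N)); split=> //.
have tele i : (i <= k)%N ->
    \sum_(l < k | (l < i)%N) (P l + t l)
    = birkhoff f rho (L i) z + sz i - sz 0%N.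
  move=> ik.
  (* [g l] is the time at which the orbit of [(z, 0)] starts to shadow piece [l]; gap plus duration
     is its increment. *)
  pose g l := birkhoff f rho (L l) z + sz l.
  rewrite (eq_bigr (fun l : 'I_k => g l.+1 - g l)).
    rewrite (sum_ord_telescope g)// /g.
    by rewrite {2}/L big_pred0// birkhoff0 add0r.
  move=> l _; rewrite /g; have -> : L l.+1 = (L l + ((j l).+2 + p l))%N.
    by rewrite addnC; exact: sum_ord_ltS.
  by rewrite /P /zz szE (birkhoffD _ _ (L l)); ring.
move=> i u /andP[u0 ut].
have [/andP[s0 _] aiE] := ams i.
have -> : (if i == 0%N :> nat then orbit_pt f rho_ge0 z (sz 0%N)
    else susp_flow (\sum_(l < k | (l < i)%N) (P l + t l))
           (orbit_pt f rho_ge0 z (sz 0%N)))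
    = orbit_pt f rho_ge0 (zz i) (s i).
  have Li0 := birkhoff_ge0 f c0 rhoc (L i) z.
  rewrite -(orbit_pt_shift f rho_ge0 c0 rhoc)//; case: eqP => [i0|_].
    by rewrite -szE i0 /L big_pred0// birkhoff0 add0r.
  have tei := tele i (ltnW (ltn_ord i)).
  have /andP[sz0 _] := sz_bd 0%N; have /andP[szi _] := sz_bd i.
  rewrite (susp_flow_orbit_pt f rho_ge0 c0 rhoc)//.
    by rewrite tei szE; congr orbit_pt; ring.
  by apply: sumr_ge0 => l _; have /andP[P0 _] := P_bd l; exact: addr_ge0.
rewrite aiE !(susp_flow_orbit_pt f rho_ge0 c0 rhoc)//.
have /andP[_ stj] := jP i.
have su0 : 0 <= s i + u by rewrite addr_ge0.
have su_lt : s i + u < birkhoff f rho (j i).+2 (m i).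
  rewrite birkhoffSr (le_lt_trans (lerD (lexx (s i)) ut))//.
  by rewrite (lt_le_trans stj)// lerDl.
have := bw_dist_orbit_pt_le rho_ge0 c0 rhoc su0 su_lt (zzP i) (Bzz i).
by move/le_lt_trans; apply; lra.
Unshelve. all: by end_near.
Qed.
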